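(* There are $2^{\mathfrak{c}}$ pairwise non-homeomorphic compactifications of $\omega$ whose remainder is homeomorphic to $D^{\mathfrak{c}}$.
   Context: $\omega$ is the countably infinite discrete space. A compactification of $\omega$ is a compact Hausdorff space $b\omega$ containing $\omega$ (with its discrete topology) as a dense subspace; its remainder is the subspace $b\omega\setminus\omega$. $\mathfrak{c}=2^{\aleph_0}$. $D=\{0,1\}$ is the two-point discrete space and $D^{\mathfrak{c}}$ carries the product topology. Two compactifications are called homeomorphic if they are homeomorphic as topological spaces. *)

(* Defs.v *)
From HB Require Import structures.
From mathcomp Require Import all_boot.
From mathcomp Require Import all_classical.
From mathcomp Require Import topology function_spaces.

Set Implicit Arguments.
Unset Strict Implicit.
Unset Printing Implicit Defensive.

Local Open Scope classical_set_scope.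

Definition homeomorphism (X Y : topologicalType) (f : X -> Y) : Prop :=
  continuous f /\
  exists g : Y -> X, [/\ continuous g, cancel f g & cancel g f].

Definition homeomorphic (X Y : topologicalType) : Prop :=
  exists f : X -> Y, homeomorphism f.

(* The topology of X is the one induced by Y through the injection f, i.e. f
   is a homeomorphism of X onto the subspace [range f] of Y. *)
Definition topological_embedding (X Y : topologicalType) (f : X -> Y) : Prop :=
  injective f /\ @open X = @open (initial_topology f).

(* [nat] carries the discrete topology in the library; the inclusion of omega
   into the compactification is the embedding [omega_in]. *)
Record compactification_of_omega := Compactification {
  cspace :> topologicalType;
  omega_in : nat -> cspace;
  cspace_compact : compact [set: cspace];
  cspace_hausdorff : hausdorff_space cspace;
  omega_in_embedding : topological_embedding omega_in;
  omega_in_dense : dense (range omega_in) }.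

(* A set coerced to a type carries the subspace topology. *)
Definition remainder (b : compactification_of_omega) : topologicalType :=
  set_type (~` range (omega_in b)).

(* A set of cardinality 2 ^ aleph_0; it serves both as the index set of the
   power D^c and, through [continuum -> bool], to represent 2 ^ c. *)
Definition continuum : Type := nat -> bool.

(* D^c with the product topology, [bool] being discrete. *)
Definition cantor_cube : topologicalType :=
  prod_topology (fun _ : continuum => bool).

(* Main.v *)
Require Import Defs.
From mathcomp Require Import all_boot.
From mathcomp Require Import all_classical.
From mathcomp Require Import topology function_spaces.

(* For an independent family (A_i) of c subsets of omega, the points
   (delta_n, (A_i(n))_i) of the cube 2^(omega + c) form a discrete set whose
   closure adds exactly the points (0, z) with z in 2^c: this is a
   compactification of omega with remainder D^c.  Choosing, for each of c
   indices, one of two sets of a fixed independent family gives 2^c such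
   compactifications K f.  A homeomorphism from K f to K g permutes omega, and
   f and this permutation determine g: a continuous map from K g to K g' fixing
   omega would make each A'_i agree, near a limit point of K g, with a constant,
   which independence forbids when A'_i is not one of the sets defining K g.
   So every homeomorphism class has at most c members, and a diagonal argument
   in the style of Koenig extracts 2^c classes. *)

Set Implicit Arguments.
Unset Strict Implicit.
Unset Printing Implicit Defensive.

Local Open Scope classical_set_scope.

(** * Basic neighbourhoods in cubes, and homeomorphism as an equivalence relation *)

Notation cube I := (prod_topology (fun _ : I => bool)).

Lemma cube_nbhsP (I : eqType) (p : cube I) (U : set (cube I)) :
  nbhs p U <-> exists s : seq I, forall q, {in s, q =1 p} -> U q.
Proof.
split=> [pU|[s sU]].
  pose F := filter_from [set: seq I]
    (fun s => [set q : cube I | {in s, q =1 p}]).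
  have FF : Filter F.
    apply: filter_from_filter; first by exists [::].
    move=> s t _ _; exists (s ++ t) => // q stq.
    by split=> i si; apply: stq; rewrite mem_cat si ?orbT.
  (* The product topology is a supremum over the projections, so convergence is checked one
     coordinate at a time. *)
  have /(_ U pU) [s _ sU] : F --> p.
    apply/cvg_sup => i V [_ [[W oW <-] Wp] WV].
    exists [:: i] => // q qp; apply: WV; rewrite /preimage /= qp //.
    by rewrite inE.
  by exists s => q; exact: sU.
elim: s U sU => [|i s IHs] U sU.
  by apply: filterS (@filterT _ (nbhs p) _) => q _; exact: sU.
have pi : nbhs p [set q : cube I | q i = p i].
  exact: (@proj_continuous I (fun=> bool) i p _ (discrete_set1 (p i))).
have ps : nbhs p [set q : cube I | {in s, q =1 p}] by exact: IHs.
apply: filterS (filterI pi ps) => q [/= qi qs]; apply: sU => j.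
by rewrite inE => /predU1P[->//|]; exact: qs.
Qed.

Lemma homeomorphic_refl (X : topologicalType) : homeomorphic X X.
Proof.
by exists id; split; [|exists id; split=> //]; move=> x; exact: cvg_id.
Qed.

Lemma homeomorphic_sym (X Y : topologicalType) :
  homeomorphic X Y -> homeomorphic Y X.
Proof.
by move=> [f [fc [g [gc fK gK]]]]; exists g; split=> //; exists f; split.
Qed.

Lemma homeomorphic_trans (Y X Z : topologicalType) :
  homeomorphic X Y -> homeomorphic Y Z -> homeomorphic X Z.
Proof.
move=> [f [fc [f' [f'c fK f'K]]]] [g [gc [g' [g'c gK g'K]]]].
exists (g \o f); split.
  by move=> x; exact: (continuous_comp (fc x) (gc _)).
exists (f' \o g'); split.
- by move=> x; exact: (continuous_comp (g'c x) (f'c _)).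
- exact: can_comp.
- exact: can_comp.
Qed.

(* [E x f g] means that [x] codes a witness of [R f g].  If every [x] had a value
   [d x] not attained at [x] by any [g] reached by [E x] from a representative,
   then no [x] could code a witness that [d] is related to its own
   representative.  So some [x] has none, and a representative is chosen for
   each value in [S]. *)
Lemma diagonal_transversal (C S : Type) (R : (C -> S) -> (C -> S) -> Prop)
    (E : C -> (C -> S) -> (C -> S) -> Prop) :
    (forall f, R f f) -> (forall f g, R f g -> R g f) ->
    (forall g f h, R f g -> R g h -> R f h) ->
    (forall f g, R f g -> exists x, E x f g) ->
    (forall x f g h, E x f g -> E x f h -> g = h) ->
  exists b : S -> C -> S, forall i j, i <> j -> ~ R (b i) (b j).
Proof.
move=> Rxx Rsym Rtrans RE Efun.
pose r f := projT1 (cid (ex_intro (R f) f (Rxx f))).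
have Rr f : R f (r f) by rewrite /r; case: cid.
have rR f g : R f g -> r f = r g.
  (* Equal classes make [cid] choose the same representative, once the existence proofs are
     identified. *)
  move=> Rfg; have RfE : R f = R g.
    by apply/predeqP => h; split=> [|/(Rtrans _ _ _ Rfg)//]; exact/Rtrans/Rsym.
  rewrite /r; move: (ex_intro _ _ _) (ex_intro _ _ _); rewrite RfE => e1 e2.
  by rewrite (Prop_irrelevance e1 e2).
have [x xS] : exists x, forall s, exists f, exists2 g, E x (r f) g & g x = s.
  apply: contrapT => /forallNP noS.
  have /choice[d dP] x : exists s, ~ exists f, exists2 g, E x (r f) g & g x = s.
    by have /existsNP := noS x.
  have [x Ex] := RE _ _ (Rsym _ _ (Rr d)).
  by apply: (dP x); exists d, d.
have {xS}[b bP] := choice xS.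
exists (r \o b) => i j ij /= Rij; apply: ij.
have [[g Eg <-] [h Eh <-]] := (bP i, bP j).
have rE : r (b i) = r (b j).
  exact: rR (Rtrans _ _ _ (Rr _) (Rtrans _ _ _ Rij (Rsym _ _ (Rr _)))).
by move: Eg; rewrite rE => /Efun /(_ Eh) ->.
Qed.

(** * Independent families of subsets of omega *)

(** Avoiding any finite [t] makes each Boolean combination infinite; density of omega needs this, as
    a neighbourhood of a limit may exclude finitely many integers. *)
Definition independent (I : eqType) (A : I -> nat -> bool) :=
  forall (s : seq I) (p : I -> bool) (t : seq nat),
    exists2 k, k \notin t & {in s, forall i, A i k = p i}.

Lemma injective_notin_seq (u : nat -> nat) (t : seq nat) :
  injective u -> exists j, u j \notin t.
Proof.
move=> u_inj; apply: contrapT => /forallNP ut.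
have : {subset map u (iota 0 (size t).+1) <= t}.
  by move=> _ /mapP[j _ ->]; apply: contrapT => /negP /ut.
move/uniq_leq_size; rewrite map_inj_uniq// iota_uniq => /(_ isT).
by rewrite size_map size_iota ltnn.
Qed.

(** Two distinct sequences split at a finite length; the maximum over all pairs serves the whole
    list. *)
Lemma seq_separation (ys : seq (nat -> bool)) :
  exists n, {in ys &, injective (fun y => mkseq y n)}.
Proof.
have sep (y z : nat -> bool) : exists n,
    forall m, (n <= m)%N -> mkseq y m = mkseq z m -> y = z.
  have [<-|/eqP yz] := eqVneq y z; first by exists 0.
  have [k yzk] : exists k, y k <> z k.
    apply: contrapT => /forallNP yzE; apply: yz.
    by apply/funext => k; exact: contrapT (yzE k).
  exists k.+1 => m km /(congr1 (nth false ^~ k)).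
  by rewrite !nth_mkseq.
have /choice[N NP] : forall yz : (nat -> bool) * (nat -> bool), exists n,
    forall m, (n <= m)%N -> mkseq yz.1 m = mkseq yz.2 m -> yz.1 = yz.2.
  by move=> [y z]; exact: sep.
exists (\max_(y <- ys) \max_(z <- ys) N (y, z)) => y z ysy ysz.
apply: (NP (y, z)); apply: leq_trans (leq_bigmax_seq _ ysy isT).
exact: leq_bigmax_seq _ ysz isT.
Qed.

(* [k] codes a triple of a padding, a length [n] and a finite set [F] of binary
   words, and belongs to the set of index [y] when the prefix of [y] of length
   [n] is in [F]; the padding provides infinitely many codes of each [(n, F)]. *)
Definition prefix_family (y : nat -> bool) (k : nat) : bool :=
  if @unpickle (nat * nat * seq bitseq)%type k is Some (_, n, F)
  then mkseq y n \in F else false.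

Lemma prefix_family_independent : independent prefix_family.
Proof.
move=> ys p t; have [n n_inj] := seq_separation ys.
pose F := [seq mkseq y n | y <- ys & p y].
have [|j jt] := @injective_notin_seq (fun j => pickle (j, n, F)) t.
  by move=> i j /(pcan_inj pickleK) [].
exists (pickle (j, n, F)) => // y ysy; rewrite /prefix_family pickleK.
apply/mapP/idP => [[z]|py]; last by exists y => //; rewrite mem_filter py.
by rewrite mem_filter => /andP[pz zys] /(n_inj _ _ ysy zys) ->.
Qed.

(** * Topology of subspaces of cubes *)

Lemma subtype_nbhsP (X : topologicalType) (K : set X) (x : K) (U : set K) :
  nbhs x U <-> exists2 V, nbhs (set_val x) V & set_val @^-1` V `<=` U.
Proof.
split=> [[_ [[V oV <-] Vx] VU]|[V + VU]].
  by exists V => //; exact: open_nbhs_nbhs.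
by move=> /(@initial_continuous _ _ set_val x); apply: (filterS VU).
Qed.

Lemma cube_subtype_nbhsP (I : eqType) (K : set (cube I)) (x : K) (U : set K) :
  nbhs x U <->
  exists s : seq I, forall y : K, {in s, set_val y =1 set_val x} -> U y.
Proof.
rewrite subtype_nbhsP; split=> [[V /cube_nbhsP[s sV] VU]|[s sU]].
  by exists s => y ys; apply: VU; exact: sV.
exists [set q : cube I | {in s, q =1 set_val x}]; last exact: sU.
by apply/cube_nbhsP; exists s.
Qed.

Lemma subtype_compact (X : topologicalType) (K : set X) :
  compact K -> compact [set: set_type K].
Proof.
move=> Kc F FF _; have [p [Kp clp]] : K `&` cluster (set_val @ F) !=set0.
  apply: Kc; apply: (@filterS _ F _ _ (set_val @^-1` K) _ (@filterT _ F _)).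
  by move=> x _; exact: set_valP x.
exists (exist _ p (mem_set Kp)); split=> // U V FU /subtype_nbhsP[W pW WV].
have [x [[y Uy <-] Wx]] : set_val @` U `&` W !=set0.
  apply: clp => //; apply: (filterS _ FU : F (set_val @^-1` _)) => y Uy.
  by exists y.
by exists y; split=> //; exact: WV.
Qed.

Lemma cube_compact (I : eqType) : compact [set: cube I].
Proof.
have := @tychonoff I (fun=> bool) (fun=> setT) (fun=> bool_compact).
by congr (compact _); apply/seteqP; split.
Qed.

Lemma cube_subtype_hausdorff (I : eqType) (K : set (cube I)) :
  hausdorff_space (set_type K).
Proof.
move=> x y xy; apply: val_inj; apply/funext => i.
have n (z : K) : nbhs z [set t : K | set_val t i = set_val z i].
  apply/cube_subtype_nbhsP; exists [:: i] => t; apply; exact: mem_head.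
have [t [/= tx ty]] := xy _ _ (n x) (n y); exact: etrans (esym tx) ty.
Qed.

(** * The compactification attached to an independent family *)

Section Compactification.
Context {I : eqType} (A : I -> nat -> bool).
Hypothesis A_indep : independent A.

Definition isolated (n : nat) : cube (nat + I) :=
  fun u => match u with inl m => m == n | inr i => A i n end.

Definition limit (z : I -> bool) : cube (nat + I) :=
  fun u => match u with inl _ => false | inr i => z i end.

Definition carrier : set (cube (nat + I)) := range isolated `|` range limit.

Lemma carrier_inl p n : carrier p -> p (inl n) -> p = isolated n.
Proof. by case=> [[m _ <-] /= /eqP->|[z _ <-]]. Qed.

Lemma closed_carrier : closed carrier.
Proof.
rewrite -[carrier]setCK closedC openE => p Kp; apply/cube_nbhsP.
have [n pn] : exists n, p (inl n).
  apply: contrapT => /forallNP pN; apply: Kp; right; exists (p \o inr) => //.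
  by apply/funext => -[n|//]; apply/esym/negbTE/negP.
have [u pu] : exists u, p u <> isolated n u.
  apply: contrapT => /forallNP pE; apply: Kp; left; exists n => //.
  by apply/funext => u; exact: esym (contrapT (pE u)).
(* A point of [carrier] true at [inl n] is [isolated n], so these two coordinates exclude [carrier]
   near [p]. *)
exists [:: inl n; u] => q qp Kq; apply: pu.
by rewrite -(@carrier_inl q n) // ?qp ?inE ?eqxx ?orbT.
Qed.

Definition point (n : nat) : carrier :=
  exist _ (isolated n) (mem_set (or_introl (imageT isolated n))).

Lemma carrier_inlP (x : carrier) n : set_val x (inl n) -> x = point n.
Proof. by move=> xn; apply: val_inj; exact: carrier_inl (set_valP x) xn. Qed.

Lemma point_inj : injective point.
Proof.
move=> m n mn; have : isolated m (inl m) by exact: eqxx.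
by rewrite -[isolated m]/(set_val (point m)) mn => /eqP.
Qed.

Lemma open_point n : open [set point n].
Proof.
rewrite openE => _ ->; apply/cube_subtype_nbhsP; exists [:: inl n] => y yn.
by apply: carrier_inlP; rewrite yn ?mem_head //; exact: eqxx.
Qed.

Lemma point_embedding : topological_embedding point.
Proof.
split; first exact: point_inj.
apply/seteqP; split=> U // _; last exact: discrete_open.
exists (\bigcup_(n in U) [set point n]).
  by apply: bigcup_open => n _; exact: open_point.
by apply/seteqP; split=> [n [m Um /point_inj ->]//|n Un]; exists n.
Qed.

Lemma range_point_dense : dense (range point).
Proof.
move=> U [x Ux]; rewrite openE => /(_ _ Ux)/cube_subtype_nbhsP[s sU].
have [[n _ nx]|[z _ zx]] := set_valP x.
  by exists x; split=> //; exists n => //; exact: val_inj.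
pose si := pmap (fun u => if u is inr i then Some i else None) s.
pose sn := pmap (fun u => if u is inl n then Some n else None) s.
(* Since [k] avoids [sn], [isolated k] vanishes at the [inl] coordinates in [s], as [limit z]
   does. *)
have [k ksn ksi] := A_indep si z sn.
exists (point k); split; last by exists k.
apply: sU => u us; apply: etrans (congr1 (@^~ u) zx).
case: u us => [n|i] us /=.
  apply/negbTE; apply: contraNneq ksn => <-.
  by rewrite mem_pmap; apply/mapP; exists (inl n).
by apply: ksi; rewrite mem_pmap; apply/mapP; exists (inr i).
Qed.

Definition compactification : compactification_of_omega :=
  @Compactification (set_type carrier) point
    (subtype_compact
      (subclosed_compact closed_carrier (@cube_compact _) (@subsetT _ _)))
    (@cube_subtype_hausdorff _ _) point_embedding range_point_dense.

Definition limit_point (z : I -> bool) : carrier :=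
  exist _ (limit z) (mem_set (or_intror (imageT limit z))).

Lemma limit_point_remainder z : limit_point z \in ~` range point.
Proof.
apply/mem_set => -[n _ nz]; have : isolated n (inl n) by exact: eqxx.
by rewrite -[isolated n]/(set_val (point n)) nz.
Qed.

Lemma remainder_compactification :
  homeomorphic (remainder compactification) (cube I).
Proof.
pose phi (x : remainder compactification) : cube I :=
  fun i => set_val (set_val x) (inr i).
pose psi (z : cube I) : remainder compactification :=
  exist (fun x => x \in ~` range point) _ (limit_point_remainder z).
exists phi; split=> [x U /cube_nbhsP[s sU]|].
  apply/subtype_nbhsP.
  exists [set y : carrier | {in map inr s, set_val y =1 set_val (set_val x)}].
    by apply/cube_subtype_nbhsP; exists (map inr s).
  by move=> y ys; apply: sU => i si; apply: ys; exact: map_f.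
exists psi; split=> [z U /subtype_nbhsP[V /cube_subtype_nbhsP[s sV] VU]|x|z].
- apply/cube_nbhsP.
  exists (pmap (fun u => if u is inr i then Some i else None) s) => y ys.
  apply: VU; apply: sV => -[//|i] us.
  by apply: ys; rewrite mem_pmap; apply/mapP; exists (inr i).
- apply: val_inj; apply: val_inj; apply/funext => -[n|//].
  apply/esym/negbTE/negP => /carrier_inlP xn.
  by have := set_valP x; apply; exists n.
- by [].
Qed.

End Compactification.

(* A basic neighbourhood of the limit point 0 involves finitely many [A j], so by
   the hypothesis it contains points of omega on both sides of [B i]. *)
Lemma no_map_fixing_points (I : eqType) (A B : I -> nat -> bool)
    (A_indep : independent A) (B_indep : independent B) (i : I) :
  (forall (s : seq I) p (t : seq nat) b,
    exists2 k, k \notin t & {in s, forall j, A j k = p j} /\ B i k = b) ->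
  forall h : compactification A_indep -> compactification B_indep,
    continuous h -> ~ forall n, h (point A n) = point B n.
Proof.
move=> AB h hc hpt.
pose z : compactification A_indep := limit_point A (fun=> false).
pose b := set_val (h z) (inr i).
have /hc/cube_subtype_nbhsP[s sb] :
    nbhs (h z) [set y : carrier B | set_val y (inr i) = b].
  apply/cube_subtype_nbhsP; exists [:: inr i] => y; apply; exact: mem_head.
pose si := pmap (fun u => if u is inr i then Some i else None) s.
pose sn := pmap (fun u => if u is inl n then Some n else None) s.
have [k ksn [ksi Bk]] := AB si (fun=> false) sn (~~ b).
have : set_val (h (point A k)) (inr i) = b.
  apply: sb => -[n|j] us /=.
    apply/negbTE; apply: contraNneq ksn => <-.
    by rewrite mem_pmap; apply/mapP; exists (inl n).
  by apply: ksi; rewrite mem_pmap; apply/mapP; exists (inr j).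
rewrite hpt => kb; have : B i k = b by exact: kb.
by rewrite Bk; case: (b).
Qed.

(** * Coding of 2^c independent families *)

Definition interleave (x y : continuum) : continuum :=
  fun n => if odd n then y n./2 else x n./2.

Definition evens (x : continuum) : continuum := fun n => x n.*2.
Definition odds (x : continuum) : continuum := fun n => x n.*2.+1.

Lemma evens_interleave x y : evens (interleave x y) = x.
Proof. by apply/funext => n; rewrite /evens /interleave odd_double doubleK. Qed.

Lemma odds_interleave x y : odds (interleave x y) = y.
Proof.
by apply/funext => n; rewrite /odds /interleave /= odd_double uphalf_double.
Qed.

Definition cons_seq (b : bool) (x : continuum) : continuum :=
  fun n => if n is m.+1 then x m else b.

Lemma cons_seq_inj b c x y : cons_seq b x = cons_seq c y -> b = c /\ x = y.
Proof.
move=> e; split; first exact: (congr1 (@^~ 0) e).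
by apply/funext => n; exact: (congr1 (@^~ n.+1) e).
Qed.

(** The bit of [f] selects one of the two sets with indices [cons_seq false x] and
    [cons_seq true x]; the tail [x] keeps indices distinct. *)
Definition coded_family (f : continuum -> continuum -> bool) (x : continuum) :=
  prefix_family (cons_seq (f (evens x) (odds x)) x).

Lemma coded_family_independent f : independent (coded_family f).
Proof.
move=> s p t.
have [k kt ks] := prefix_family_independent
  [seq cons_seq (f (evens x) (odds x)) x | x <- s] (fun y => p (y \o S)) t.
exists k => // x xs; rewrite [LHS]ks; last by apply/mapP; exists x.
by congr p; apply/funext.
Qed.

(** Where [f] and [g] differ, the index [gx] used by [g] is not among those used by [f], so its
    value is free. *)
Lemma coded_family_split f g x (s : seq continuum) p (t : seq nat) b :
    f (evens x) (odds x) <> g (evens x) (odds x) ->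
  exists2 k, k \notin t &
    {in s, forall y, coded_family f y k = p y} /\ coded_family g x k = b.
Proof.
move=> fg; pose gx := cons_seq (g (evens x) (odds x)) x.
have [k kt ks] := prefix_family_independent
  (gx :: [seq cons_seq (f (evens x) (odds x)) x | x <- s])
  (fun y : continuum => if y == gx then b else p (y \o S)) t.
exists k => //; split=> [y ys|]; last by rewrite [LHS]ks ?mem_head// eqxx.
rewrite [LHS]ks; last by rewrite inE; apply/orP; right; apply/mapP; exists y.
case: eqP => [/cons_seq_inj[fgy yx]|_]; last by congr p; apply/funext.
by move: fgy; rewrite yx.
Qed.

Definition coded_compactification f :=
  compactification (coded_family_independent f).

(** The map [h'] after the inverse of [h] fixes omega pointwise, which is impossible if [g] and [g']
    differ. *)
Lemma coded_homeomorphism_inj f g g'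
    (h : coded_compactification f -> coded_compactification g)
    (h' : coded_compactification f -> coded_compactification g') :
    homeomorphism h -> homeomorphism h' ->
    (forall n m, h (point _ n) = point _ m -> h' (point _ n) = point _ m) ->
  g = g'.
Proof.
move=> [hc [k [kc hK kK]]] [h'c _] hh'.
apply: contrapT => gg'.
have [x gx] : exists x, g (evens x) (odds x) <> g' (evens x) (odds x).
  apply: contrapT => /forallNP gE; apply: gg'; apply/funext => x.
  apply/funext => y; have /contrapT := gE (interleave x y).
  by rewrite evens_interleave odds_interleave.
apply: (@no_map_fixing_points _ _ _ (coded_family_independent g)
  (coded_family_independent g') x _ (h' \o k)).
- by move=> s p t b; exact: coded_family_split.
- by move=> y; exact: (continuous_comp (kc y) (h'c _)).
(* The preimage of an isolated point is open and nonempty, so by density it contains a point of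
   omega. *)
move=> m /=; have [y [/= hm [n _ nE]]] :=
  @omega_in_dense (coded_compactification f)
  (h @^-1` [set point (coded_family g) m])
  (ex_intro _ (k (point _ m)) (kK _))
  ((continuousP _).1 hc _ (@open_point _ _ m)).
rewrite -nE in hm.
by rewrite -hm hK; exact: hh'.
Qed.

Theorem theorem3 :
  exists b : (continuum -> bool) -> compactification_of_omega,
    (forall i, homeomorphic (remainder (b i)) cantor_cube) /\
    (forall i j, i <> j -> ~ homeomorphic (b i) (b j)).
Proof.
pose K := coded_compactification.
(* [x] codes the graph of the trace of a homeomorphism on omega. *)
pose E x f g := exists2 h : K f -> K g, homeomorphism h &
  forall n m, x (pickle (n, m)) <-> h (point _ n) = point _ m.
have [|||||b bP] := @diagonal_transversal continuum (continuum -> bool)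
  (fun f g => homeomorphic (K f) (K g)) E.
- by move=> f; exact: homeomorphic_refl.
- by move=> f g; exact: homeomorphic_sym.
- by move=> g f h; exact: homeomorphic_trans.
- move=> f g [h hh].
  exists (fun c => if unpickle c is Some (n, m)
    then `[< h (point _ n) = point _ m >] else false).
  by exists h => // n m; rewrite pickleK; split=> /asboolP.
- move=> x f g g' [h hh xh] [h' hh' xh'].
  by apply: (coded_homeomorphism_inj hh hh') => n m /xh /xh'.
exists (K \o b); split=> [i|i j ij]; last exact: bP.
exact: remainder_compactification.
Qed.
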